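(* Let $A$ be a commutative unital ring with nonzero multiplicative identity $1_A$, and let $B\subsetneq A$ be an ideal of $A$ which, as a ring, has a nonzero multiplicative identity $1_B$. Put $$S=\begin{pmatrix} A & A & B \\ A & A & B \\ B & B & A \end{pmatrix},\quad R=\begin{pmatrix} A & A & 0 \\ A & A & 0 \\ 0 & 0 & A \end{pmatrix},\quad T=\begin{pmatrix} 0 & 0 & B \\ 0 & 0 & B \\ B & B & 0 \end{pmatrix},$$ regarded as subsets of the matrix ring $M_3(A)$, with $S$ a ring under the matrix operations. Then the ring $S$ is epsilon-strongly $\mathbb{Z}_2$-graded with $S_0=R$ and $S_1=T$. With this grading, $S$ is neither strongly graded, nor a unital partial crossed product of $\mathbb{Z}_2$ over $R$. Moreover, the ring extension $S/R$ is separable.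
   Context: Matrix notation such as $\begin{pmatrix} A & A & B \\ A & A & B \\ B & B & A \end{pmatrix}$ means the set of all $3\times3$ matrices with entries in the indicated sets. $XY$ denotes the set of finite sums of products $xy$ with $x\in X$, $y\in Y$. Let $G$ be a group with identity $e$ (here $G=\mathbb{Z}_2$, written additively, $e=0$). Gradings: $S$ is graded by $G$ if there are additive subgroups $S_g\subseteq S$ with $S=\bigoplus_{g\in G}S_g$ and $S_gS_h\subseteq S_{gh}$ for all $g,h\in G$. It is strongly graded if $S_gS_h=S_{gh}$ for all $g,h$. An ideal of $S_e$ is called unital if it has its own multiplicative identity element (allowed to be $0$). $S$ is epsilon-strongly graded by $G$ if for each $g\in G$, $S_gS_{g^{-1}}$ is a unital ideal of $S_e$, and for all $g,h\in G$: $S_gS_h=S_gS_{g^{-1}}S_{gh}=S_{gh}S_{h^{-1}}S_h$. Unital twisted partial action of $G$ on $R$: a triple $\alpha=(\{D_g\}_{g\in G},\{\alpha_g\}_{g\in G},\{w_{g,h}\}_{(g,h)\in G\times G})$ where for each $g$, $D_g$ is a unital ideal of $R$ with (not necessarily nonzero) identity element $1_g$, central in $R$; $\alpha_g:D_{g^{-1}}\to D_g$ is an isomorphism of rings; each $w_{g,h}$ is an invertible element of $D_gD_{gh}$ (a ring with identity $1_g1_{gh}$), such that for all $g,h,l\in G$: (P1) $\alpha_e=\mathrm{id}_R$; (P2) $\alpha_g(D_{g^{-1}}D_h)=D_gD_{gh}$; (P3) if $r\in D_{h^{-1}}D_{(gh)^{-1}}$, then $\alpha_g(\alpha_h(r))=w_{g,h}\alpha_{gh}(r)w_{g,h}^{-1}$;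 (P4) $w_{e,g}=w_{g,e}=1_g$; (P5) if $r\in D_{g^{-1}}D_hD_{hl}$, then $\alpha_g(rw_{h,l})w_{g,hl}=\alpha_g(r)w_{g,h}w_{gh,l}$. The unital partial crossed product $R\star_\alpha^wG=\bigoplus_{g\in G}D_g\delta_g$ ($\delta_g$ formal symbols) has multiplication given by biadditive extension of (P6) $(r\delta_g)(r'\delta_h)=r\alpha_g(r'1_{g^{-1}})w_{g,h}\delta_{gh}$, for $r\in D_g$, $r'\in D_h$. A $G$-graded ring $S$ with $S_e=R$ is a unital partial crossed product of $G$ over $R$ if there are a unital twisted partial action of $G$ on $R$ and a ring isomorphism $S\to R\star_\alpha^wG$ mapping $S_g$ onto $D_g\delta_g$ for every $g\in G$ and each $r\in R$ to $r\delta_e$. Separability: $S/R$ is separable if there is $x\in S\otimes_RS$ with $m(x)=1$, where $m:S\otimes_RS\to S$ is the multiplication map, and $sx=xs$ for all $s\in S$. *)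

(* Defs.v *)
From HB Require Import structures.
From mathcomp Require Import all_boot all_order all_fingroup all_algebra.
From mathcomp Require Import boolp classical_sets functions.

Set Implicit Arguments.
Unset Strict Implicit.
Unset Printing Implicit Defensive.

Import GRing.Theory.
Local Open Scope classical_set_scope.
Local Open Scope ring_scope.

Section SubsetsOfARing.
Variable S : pzRingType.
Implicit Types X Y R I : set S.

Definition additive_subgroup X : Prop :=
  X 0 /\ forall x y, X x -> X y -> X (x - y).

Definition set_prod X Y : set S :=
  [set z | exists2 s : seq (S * S),
     {in s, forall p, X p.1 /\ Y p.2} & z = \sum_(p <- s) p.1 * p.2].

Definition ideal_of R I : Prop :=
  [/\ additive_subgroup I, I `<=` R &
      forall r x, R r -> I x -> I (r * x) /\ I (x * r)].

Definition identity_of I (u : S) : Prop :=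
  I u /\ forall x, I x -> u * x = x /\ x * u = x.

Definition unital_ideal_of R I : Prop :=
  ideal_of R I /\ exists u, identity_of I u.

End SubsetsOfARing.

Infix "**" := set_prod (at level 40, left associativity).

(* The grading group is finite and written multiplicatively; the group law
   MathComp attaches to ['Z_2] is the addition modulo 2. *)
Section Gradings.
Variables (S : pzRingType) (G : finGroupType).

Definition graded (S_ : G -> set S) : Prop :=
  [/\ forall g, additive_subgroup (S_ g),
      forall s : S, exists! f : {ffun G -> S},
        (forall g, S_ g (f g)) /\ s = \sum_g f g &
      forall g h, S_ g ** S_ h `<=` S_ (g * h)%g].

Definition strongly_graded (S_ : G -> set S) : Prop :=
  graded S_ /\ forall g h, S_ g ** S_ h = S_ (g * h)%g.

Definition epsilon_strongly_graded (S_ : G -> set S) : Prop :=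
  [/\ graded S_,
      forall g, unital_ideal_of (S_ 1%g) (S_ g ** S_ g^-1%g) &
      forall g h,
        S_ g ** S_ h = S_ g ** S_ g^-1%g ** S_ (g * h)%g /\
        S_ g ** S_ h = S_ (g * h)%g ** S_ h^-1%g ** S_ h].

End Gradings.

(* The base ring is a subset [R] of an ambient ring [S] (a subring in all
   uses).  [pact g] is a total function on [S] of which only the restriction
   to [pdom g^-1] is meaningful; [twV g h] is the inverse of [tw g h] in the
   ring [pdom g ** pdom (g * h)], whose identity is [pone g * pone (g * h)]. *)
Record twisted_partial_action (S : pzRingType) (G : finGroupType)
    (R : set S) := TwistedPartialAction {
  pdom : G -> set S;
  pone : G -> S;
  pact : G -> S -> S;
  tw : G -> G -> S;
  twV : G -> G -> S;
  pdom_ideal : forall g, ideal_of R (pdom g);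
  pone_identity : forall g, identity_of (pdom g) (pone g);
  pone_central : forall g r, R r -> pone g * r = r * pone g;
  pact_bij : forall g, set_bij (pdom g^-1%g) (pdom g) (pact g);
  pact_add : forall g x y, pdom g^-1%g x -> pdom g^-1%g y ->
    pact g (x + y) = pact g x + pact g y;
  pact_mul : forall g x y, pdom g^-1%g x -> pdom g^-1%g y ->
    pact g (x * y) = pact g x * pact g y;
  tw_dom : forall g h, (pdom g ** pdom (g * h)%g) (tw g h);
  twV_dom : forall g h, (pdom g ** pdom (g * h)%g) (twV g h);
  tw_twV : forall g h, tw g h * twV g h = pone g * pone (g * h)%g;
  twV_tw : forall g h, twV g h * tw g h = pone g * pone (g * h)%g;
  pact1 : pdom 1%g = R /\ forall r, R r -> pact 1%g r = r;
  pact_dom : forall g h,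
    pact g @` (pdom g^-1%g ** pdom h) = pdom g ** pdom (g * h)%g;
  pact_comp : forall g h r, (pdom h^-1%g ** pdom (g * h)^-1%g) r ->
    pact g (pact h r) = tw g h * pact (g * h)%g r * twV g h;
  tw1 : forall g, tw 1%g g = pone g /\ tw g 1%g = pone g;
  tw_cocycle : forall g h l r,
    (pdom g^-1%g ** pdom h ** pdom (h * l)%g) r ->
    pact g (r * tw h l) * tw g (h * l)%g = pact g r * tw g h * tw (g * h)%g l
}.

Section CrossedProduct.
Variables (S : pzRingType) (G : finGroupType).

(* The formal sum of the [r_g delta_g] is the finite function [g |-> r_g]. *)
Definition crossed_carrier (R : set S) (a : twisted_partial_action G R) :
    set {ffun G -> S} :=
  [set f : {ffun G -> S} | forall g, pdom a g (f g)].

Definition crossed_mul (R : set S) (a : twisted_partial_action G R)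
    (f f' : {ffun G -> S}) : {ffun G -> S} :=
  [ffun k => \sum_(g : G) \sum_(h : G | (g * h)%g == k)
     f g * pact a g (f' h * pone a g^-1%g) * tw a g h].

Definition delta (g : G) (r : S) : {ffun G -> S} :=
  [ffun k => if k == g then r else 0].

Definition unital_partial_crossed_product (S_ : G -> set S) : Prop :=
  graded S_ /\
  exists (a : twisted_partial_action G (S_ 1%g)) (phi : S -> {ffun G -> S}),
    [/\ set_bij [set: S] (crossed_carrier a) phi,
        forall x y, phi (x + y) = phi x + phi y,
        forall x y, phi (x * y) = crossed_mul a (phi x) (phi y),
        forall g, phi @` S_ g = delta g @` pdom a g &
        forall r, S_ 1%g r -> phi r = delta 1%g r].

End CrossedProduct.

Section Separability.
Variables (S : pzRingType) (R : set S).

(* An element of the tensor product of [S] with itself over [R] is the class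
   of a formal sum of pure tensors, i.e. of a list of pairs, modulo the
   congruence generated by commutativity and the tensor relations.  The
   relation [tens_zero] makes the quotient of the free commutative monoid a
   group, [(- s) (x) t] being the opposite of [s (x) t]. *)
Inductive tensor_eq : seq (S * S) -> seq (S * S) -> Prop :=
| tens_refl x : tensor_eq x x
| tens_sym x y : tensor_eq x y -> tensor_eq y x
| tens_trans x y z : tensor_eq x y -> tensor_eq y z -> tensor_eq x z
| tens_cat x x' y y' :
    tensor_eq x x' -> tensor_eq y y' -> tensor_eq (x ++ y) (x' ++ y')
| tens_comm x y : tensor_eq (x ++ y) (y ++ x)
| tens_zero t : tensor_eq [:: (0, t)] [::]
| tens_addl s s' t : tensor_eq [:: (s + s', t)] [:: (s, t); (s', t)]
| tens_addr s t t' : tensor_eq [:: (s, t + t')] [:: (s, t); (s, t')]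
| tens_bal s r t : R r -> tensor_eq [:: (s * r, t)] [:: (s, r * t)].

Definition tens_mul (x : seq (S * S)) : S := \sum_(p <- x) p.1 * p.2.

Definition tens_lact (s : S) (x : seq (S * S)) : seq (S * S) :=
  [seq (s * p.1, p.2) | p <- x].

Definition tens_ract (x : seq (S * S)) (s : S) : seq (S * S) :=
  [seq (p.1, p.2 * s) | p <- x].

Lemma tens_mul_eq x y : tensor_eq x y -> tens_mul x = tens_mul y.
Proof.
rewrite /tens_mul; elim=> //.
- by move=> {}x {}y z _ -> _ ->.
- by move=> {}x x' {}y y' _ e1 _ e2; rewrite !big_cat /= e1 e2.
- by move=> {}x {}y; rewrite !big_cat /= addrC.
- by move=> t; rewrite big_seq1 big_nil /= mul0r.
- by move=> s s' t; rewrite !big_cons !big_nil !addr0 mulrDl.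
- by move=> s t t'; rewrite !big_cons !big_nil !addr0 mulrDr.
- by move=> s r t _; rewrite !big_seq1 /= mulrA.
Qed.

Lemma tens_lact_eq s x y :
  tensor_eq x y -> tensor_eq (tens_lact s x) (tens_lact s y).
Proof.
rewrite /tens_lact; elim=> /=.
- by move=> *; exact: tens_refl.
- by move=> *; exact: tens_sym.
- by move=> {}x {}y z _ e1 _ e2; exact: tens_trans e1 e2.
- by move=> *; rewrite !map_cat; exact: tens_cat.
- by move=> *; rewrite !map_cat; exact: tens_comm.
- by move=> t; rewrite mulr0; exact: tens_zero.
- by move=> s1 s2 t; rewrite mulrDr; exact: tens_addl.
- by move=> *; exact: tens_addr.
- by move=> s1 r t Rr; rewrite mulrA; exact: tens_bal.
Qed.

Lemma tens_ract_eq s x y :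
  tensor_eq x y -> tensor_eq (tens_ract x s) (tens_ract y s).
Proof.
rewrite /tens_ract; elim=> /=.
- by move=> *; exact: tens_refl.
- by move=> *; exact: tens_sym.
- by move=> {}x {}y z _ e1 _ e2; exact: tens_trans e1 e2.
- by move=> *; rewrite !map_cat; exact: tens_cat.
- by move=> *; rewrite !map_cat; exact: tens_comm.
- by move=> t; exact: tens_zero.
- by move=> *; exact: tens_addl.
- by move=> s1 t1 t2; rewrite mulrDl; exact: tens_addr.
- by move=> s1 r t Rr; rewrite -mulrA; exact: tens_bal.
Qed.

Definition separable_extension : Prop :=
  exists x : seq (S * S),
    tens_mul x = 1 /\ forall s, tensor_eq (tens_lact s x) (tens_ract x s).

End Separability.

(* The set of 3 x 3 matrices whose entries lie in the given sets, listed row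
   by row. *)
Definition mx33 (A : pzRingType)
    (P00 P01 P02 P10 P11 P12 P20 P21 P22 : {pred A}) : {pred 'M[A]_3} :=
  let P := [:: [:: P00; P01; P02]; [:: P10; P11; P12]; [:: P20; P21; P22]] in
  fun M => [forall i : 'I_3, forall j : 'I_3,
    M i j \in nth P00 (nth [::] P i) j].

Definition Spred (A : pzRingType) (B : {pred A}) : {pred 'M[A]_3} :=
  mx33 predT predT B
       predT predT B
       B     B     predT.

Section TheRing.
Variables (A : comNzRingType) (B : idealr A).

Lemma Spred_subring_closed : subring_closed (Spred B).
Proof.
have Mr (a b : A) : b \in B -> a * b \in B by exact: idealMr.
have Ml (a b : A) : a \in B -> a * b \in B by rewrite mulrC; exact: Mr.
have SpredE (M : 'M[A]_3) : M \in Spred B =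
  [forall i : 'I_3, forall j : 'I_3,
    ((i == ord_max) == (j == ord_max)) || (M i j \in B)].
  apply: eq_forallb => i; apply: eq_forallb => j.
  by case: i => -[|[|[|]]] // ?; case: j => -[|[|[|]]].
have SP (M : 'M[A]_3) : reflect (forall i j : 'I_3,
    (i == ord_max) != (j == ord_max) -> M i j \in B)
    (M \in Spred B).
  rewrite SpredE; apply: (iffP 'forall_forallP) => H i j.
    by move/negPf=> e; move: (H i j); rewrite e.
  by case: eqP => //= /eqP; exact: H.
split=> [|M N /SP HM /SP HN|M N /SP HM /SP HN]; apply/SP=> i j neq.
- rewrite !mxE; case: (i =P j) neq => [-> |_ _]; first by rewrite eqxx.
  exact: rpred0.
- by rewrite !mxE rpredB ?HM ?HN.
- rewrite !mxE rpred_sum // => k _.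
  have [e|ne] := eqVneq (i == ord_max) (k == ord_max).
    by apply: Mr; apply: HN; rewrite -e.
  by apply: Ml; apply: HM.
Qed.

Record Smx := SMx { Smx_val :> 'M[A]_3; _ : Smx_val \in Spred B }.

HB.instance Definition _ := [isSub for Smx_val].
HB.instance Definition _ := [Choice of Smx by <:].
HB.instance Definition _ :=
  GRing.SubChoice_isSubNzRing.Build _ _ Smx Spred_subring_closed.

Definition Rset : set Smx :=
  [set M : Smx | (M : 'M[A]_3) \in
    mx33 predT     predT     (pred1 0)
         predT     predT     (pred1 0)
         (pred1 0) (pred1 0) predT].

Definition Tset : set Smx :=
  [set M : Smx | (M : 'M[A]_3) \in
    mx33 (pred1 0) (pred1 0) B
         (pred1 0) (pred1 0) B
         B         B         (pred1 0)].

End TheRing.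

Arguments Rset {A} B _.
Arguments Tset {A} B _.

Definition Z2_family (T : Type) (X0 X1 : set T) : 'Z_2 -> set T :=
  fun g => if g == 0 then X0 else X1.

(* Main.v *)
Require Import Defs.
From mathcomp Require Import all_boot all_order all_fingroup all_algebra.
From mathcomp Require Import boolp classical_sets functions.
Import GRing.Theory.
Local Open Scope ring_scope.

Set Implicit Arguments.
Unset Strict Implicit.
Unset Printing Implicit Defensive.

(** Write u for the scalar matrix with entry 1_B.  The product TT consists of
    matrices with entries in B, and it contains u, because u is the sum over i
    of the products (1_B e_ik)(1_B e_ki), where k = k(i) is one index chosen such
    that exactly one of i, k is the last.  Moreover u acts as the identity on T.  For a
    grading by a group of order two these facts suffice: TT is an ideal
    of R with identity u, TTT = T, and all the conditions of an epsilon-strong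
    grading follow ([epsilon_strongly_graded_Z2]).  The grading is not strong,
    since 1 is not in B, so that the identity matrix is not in TT.

    In a unital partial crossed product, every homogeneous component is a
    cyclic left module over the component of the identity, generated by the
    preimage of 1_g delta_g ([partial_crossed_product_cyclic]).  But T is not
    cyclic over R.  The bottom row of an element of T is a pair in B^2, on
    which R acts from the left through its last diagonal entry, an element of
    A.  If A(x, y) contained (1_B, 0) = a(x, y) and (0, 1_B) = c(x, y), then
    1_B = (ax)(cy) = (ay)(cx) = 0.

    For separability, u is a central idempotent of S, S(1 - u) = R(1 - u), and
    Su is the full matrix ring M_3(B).  The separability element is the sum of
    (1 - u) (x) 1, for the part where the extension is trivial, and the
    classical element sum_i 1_B e_i0 (x) 1_B e_0i of a full matrix ring, which
    is balanced already over the scalar matrices, all of which lie in R. *)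

(** * Products of subsets of a ring *)

Section SetProducts.
Variable S : pzRingType.
Implicit Types X Y Z R : set S.

Lemma additive_subgroupD Z x y : additive_subgroup Z -> Z x -> Z y -> Z (x + y).
Proof.
case=> Z0 ZB Zx Zy; rewrite -[y]opprK; apply: (ZB) => //.
by rewrite -sub0r; exact: ZB.
Qed.

Lemma set_prod_mul X Y x y : X x -> Y y -> (X ** Y) (x * y).
Proof.
move=> Xx Yy; exists [:: (x, y)]; last by rewrite big_seq1.
by move=> p; rewrite inE => /eqP->.
Qed.

Lemma set_prod_sub X Y Z : additive_subgroup Z ->
  (forall x y, X x -> Y y -> Z (x * y)) -> (X ** Y `<=` Z)%classic.
Proof.
move=> Zadd XYZ z [s sXY ->]; rewrite big_seq.
elim/big_ind: _ => [|x y|p /sXY[]]; first by case: Zadd.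
- exact: additive_subgroupD.
- exact: XYZ.
Qed.

(** Closure under opposites needs it of one factor only, here the left one:
    the sign of each product is absorbed there. *)
Lemma set_prod_subgroup X Y : additive_subgroup X -> additive_subgroup (X ** Y).
Proof.
case=> X0 XB; split=> [|_ _ [s sXY ->] [t tXY ->]].
  by exists [::]; rewrite ?big_nil.
exists (s ++ [seq (- p.1, p.2) | p <- t]).
  move=> p; rewrite mem_cat => /orP[/sXY//|/mapP[q /tXY[Xq Yq] ->]].
  by split=> //=; rewrite -sub0r; apply: XB.
rewrite big_cat big_map -sumrN; congr (_ + _).
by apply: eq_bigr => p _; rewrite mulNr.
Qed.

Lemma set_prod_mull R X Y r z : additive_subgroup X ->
    (forall r x, R r -> X x -> X (r * x)) -> R r -> (X ** Y) z ->
  (X ** Y) (r * z).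
Proof.
move=> Xadd RX Rr XYz; have [XY0 XYB] := set_prod_subgroup Y Xadd.
apply: (@set_prod_sub X Y [set w | (X ** Y) (r * w)]%classic _ _ z XYz).
  by split=> [|x y XYx XYy] /=; rewrite ?mulr0 ?mulrBr //; apply: XYB.
by move=> x y Xx Yy /=; rewrite mulrA; apply: set_prod_mul => //; apply: RX.
Qed.

Lemma set_prod_mulr R X Y r z : additive_subgroup X ->
    (forall y r, Y y -> R r -> Y (y * r)) -> R r -> (X ** Y) z ->
  (X ** Y) (z * r).
Proof.
move=> Xadd YR Rr XYz; have [XY0 XYB] := set_prod_subgroup Y Xadd.
apply: (@set_prod_sub X Y [set w | (X ** Y) (w * r)]%classic _ _ z XYz).
  by split=> [|x y XYx XYy] /=; rewrite ?mul0r ?mulrBl //; apply: XYB.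
by move=> x y Xx Yy /=; rewrite -mulrA; apply: set_prod_mul => //; apply: YR.
Qed.

Lemma set_prod_idl X Y u : additive_subgroup Y ->
    (forall x y, X x -> Y y -> Y (x * y)) -> X u ->
    (forall y, Y y -> u * y = y) ->
  X ** Y = Y.
Proof.
move=> Yadd XY Xu uY; apply/seteqP; split; first exact: set_prod_sub.
by move=> y Yy; rewrite -(uY y Yy); apply: set_prod_mul.
Qed.

Lemma set_prod_idr X Y u : additive_subgroup X ->
    (forall x y, X x -> Y y -> X (x * y)) -> Y u ->
    (forall x, X x -> x * u = x) ->
  X ** Y = X.
Proof.
move=> Xadd XY Yu uX; apply/seteqP; split; first exact: set_prod_sub.
by move=> x Xx; rewrite -(uX x Xx); apply: set_prod_mul.
Qed.

End SetProducts.

(** * Gradings by a group of order two *)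

Section Z2Gradings.
Variables (S : pzRingType) (R T : set S).

Lemma forall_Z2 (P : 'Z_2 -> Prop) : P 0 -> P 1 -> forall g, P g.
Proof.
move=> P0 P1 [[|[|//]] ltg].
  by rewrite (_ : Ordinal ltg = 0) //; apply: val_inj.
by rewrite (_ : Ordinal ltg = 1) //; apply: val_inj.
Qed.

Lemma sum_Z2 (f : 'Z_2 -> S) : \sum_g f g = f 0 + f 1.
Proof.
rewrite big_ord_recl big_ord1; congr (f _ + f _); exact: val_inj.
Qed.

Hypotheses (Radd : additive_subgroup R) (Tadd : additive_subgroup T).
Hypotheses (RR : forall x y, R x -> R y -> R (x * y))
  (RT : forall x y, R x -> T y -> T (x * y))
  (TR : forall x y, T x -> R y -> T (x * y))
  (TT : forall x y, T x -> T y -> R (x * y)).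
Hypotheses (RT_dec : forall s, exists2 r, R r & T (s - r))
  (RT_eq0 : forall s, R s -> T s -> s = 0).

Lemma graded_Z2 : graded (Z2_family R T).
Proof.
split; first by apply: forall_Z2.
- move=> s; have [r Rr Tsr] := RT_dec s.
  exists [ffun g : 'Z_2 => if g == 0 then r else s - r]; split.
    split; first by apply: forall_Z2; rewrite ffunE.
    by rewrite sum_Z2 !ffunE /= addrC subrK.
  move=> f [Sf def_s]; apply/ffunP.
  have [Rf Tf] := (Sf 0, Sf 1); rewrite /Z2_family /= in Rf Tf.
  have sE : s = f 0 + f 1 by rewrite def_s sum_Z2.
  have r_f0 : r = f 0.
    apply/subr0_eq/RT_eq0; first exact: Radd.2.
    suff -> : r - f 0 = f 1 - (s - r) by apply: Tadd.2.
    by rewrite sE opprB addrCA opprD [f 1 + _]addrCA subrr addr0.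
  apply: forall_Z2; rewrite ffunE //= r_f0 sE addrAC subrr add0r //.
- by apply: forall_Z2; apply: forall_Z2; apply: set_prod_sub; rewrite ?mulg1.
Qed.

Hypothesis R1 : R 1.

(** The element u is automatically an identity of TT, on the generators and
    hence on all sums.  Each of the required equations then reduces to one of
    RR = R, RT = T = TR, TTR = TT and TTT = T; only the last one uses u. *)
Lemma epsilon_strongly_graded_Z2 u : (T ** T) u ->
    (forall t, T t -> u * t = t /\ t * u = t) ->
  epsilon_strongly_graded (Z2_family R T).
Proof.
move=> TTu uT.
have TTadd : additive_subgroup (T ** T) by apply: set_prod_subgroup.
have TT_R x : (T ** T) x -> R x by apply: set_prod_sub => // *; apply: TT.
have [ul ur] : (forall x, (T ** T) x -> u * x = x) /\
               (forall x, (T ** T) x -> x * u = x).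
  split; [apply: (@set_prod_sub _ _ _ [set x | u * x = x]%classic) |
          apply: (@set_prod_sub _ _ _ [set x | x * u = x]%classic)] => /=.
  - by split=> [|x y xu yu] /=; rewrite ?mulr0 // mulrBr xu yu.
  - by move=> x y /uT[ux _] _; rewrite mulrA ux.
  - by split=> [|x y xu yu] /=; rewrite ?mul0r // mulrBl xu yu.
  - by move=> x y _ /uT[_ yu]; rewrite -mulrA yu.
have TT_mull r x : R r -> (T ** T) x -> (T ** T) (r * x).
  exact: set_prod_mull.
have TT_mulr r x : (T ** T) x -> R r -> (T ** T) (x * r).
  by move=> TTx Rr; apply: (@set_prod_mulr _ R).
have RRE : R ** R = R by apply: (set_prod_idl _ _ R1) => // *; rewrite mul1r.
have RTE : R ** T = T by apply: (set_prod_idl _ _ R1) => // *; rewrite mul1r.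
have TRE : T ** R = T by apply: (set_prod_idr _ _ R1) => // *; rewrite mulr1.
have TTRE : T ** T ** R = T ** T.
  by apply: (set_prod_idr _ _ R1) => [|x y TTx Ry|*]; rewrite ?mulr1 //;
     apply: TT_mulr.
have TTTE : T ** T ** T = T.
  apply: (set_prod_idl _ _ TTu) => // [x y /TT_R Rx|y Ty]; first exact: RT.
  by case: (uT y Ty).
have invE g : (g : 'Z_2)^-1%g = g by move: g; apply: forall_Z2; apply: val_inj.
have mul11 : (1 * 1 : 'Z_2)%g = 0 by apply: val_inj.
split; first exact: graded_Z2.
- move=> g; rewrite invE; move: g; apply: forall_Z2; rewrite /Z2_family /=.
    rewrite RRE; split; first by split=> // r x Rr Rx; split; apply: RR.
    by exists 1; split=> // x _; rewrite mul1r mulr1.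
  split; first by split=> // r x Rr TTx; split; [apply: TT_mull|apply: TT_mulr].
  by exists u; split=> // x TTx; rewrite ul ?ur.
- move=> g h; rewrite !invE.
  move: g h; apply: forall_Z2; apply: forall_Z2;
    rewrite ?mulg1 ?mul1g ?mul11 /Z2_family /=;
    by rewrite ?RRE ?RTE ?TRE ?TTTE ?TTRE ?RTE.
Qed.

End Z2Gradings.

(** * Homogeneous components of a partial crossed product *)

Section CrossedProductComponents.
Variables (S : pzRingType) (G : finGroupType).

(** The generator corresponds to 1_g delta_g: for d in D_g, which is an ideal
    of the base ring, one has
    (d delta_1)(1_g delta_g) = d alpha_1(1_g) w_(1,g) delta_g = d delta_g. *)
Lemma partial_crossed_product_cyclic (S_ : G -> set S) :
    unital_partial_crossed_product S_ ->
  forall g, exists2 t, S_ g t &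
    forall s, S_ g s -> exists2 r, S_ 1%g r & s = r * t.
Proof.
case=> _ [a [phi [phi_bij _ phiM phi_im phi1]]] g.
have [dom1 act1] := pact1 a.
have phi_inj x y : phi x = phi y -> x = y.
  by case: phi_bij => _ inj _; apply: inj; rewrite inE.
have [one_g one_g_id] := pone_identity a g.
have [one_1 one_1_id] := pone_identity a 1%g.
have [t St phi_t] : (phi @` S_ g)%classic (delta g (pone a g)).
  by rewrite phi_im; exists (pone a g).
have domR d : pdom a g d -> S_ 1%g d by case: (pdom_ideal a g) => _ + _; apply.
exists t => // s Ss.
have [d Dd phi_s] : (delta g @` pdom a g)%classic (phi s).
  by rewrite -phi_im; exists s.
exists d; first exact: domR.
apply: phi_inj; rewrite -phi_s phiM phi_t phi1; last exact: domR.
apply/ffunP=> k; rewrite !ffunE (bigD1 1%g) //=.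
rewrite [X in _ + X]big1 ?addr0 => [|i ni].
  rewrite (eq_bigl (pred1 k)) => [|h]; last by rewrite mul1g.
  rewrite big_pred1_eq !ffunE eqxx invg1; case: eqP => [->|_].
    rewrite (one_1_id _ _).2; last by rewrite dom1; apply: domR.
    rewrite act1; last exact: domR.
    rewrite (tw1 a g).1.
    by rewrite -mulrA (one_g_id _ one_g).1 (one_g_id _ Dd).2.
  rewrite mul0r act1 ?mulr0 ?mul0r // -dom1.
  by have [[]] := pdom_ideal a 1%g.
by rewrite big1 // => h _; rewrite ffunE (negPf ni) !mul0r.
Qed.

End CrossedProductComponents.

(** * Calculus of formal tensors *)

Section Tensors.
Variables (S : pzRingType) (R : set S).
Local Notation "x =t y" := (tensor_eq R x y) (at level 70).

Lemma tensor_eq_perm (x y : seq (S * S)) : perm_eq x y -> x =t y.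
Proof.
elim: x y => [|p x IHx] y.
  by rewrite perm_sym => /perm_nilP->; apply: tens_refl.
move=> /[dup] /perm_mem/(_ p); rewrite mem_head => /esym/rot_to[i z rot_y] xy.
have yz : perm_eq y (p :: z) by rewrite -rot_y perm_sym perm_rot.
have xz : perm_eq x z by rewrite -(perm_cons p) (perm_trans xy).
apply: (@tens_trans _ _ _ ([:: p] ++ z)).
  by apply: (@tens_cat _ _ [:: p]); [apply: tens_refl|apply: IHx].
by rewrite cat1s -rot_y /rot -[X in _ =t X](cat_take_drop i); apply: tens_comm.
Qed.

Lemma tensor_eq_map (I : Type) (s : seq I) (f : I -> S * S)
    (F : I -> seq (S * S)) :
    (forall i, [:: f i] =t F i) ->
  [seq f i | i <- s] =t flatten [seq F i | i <- s].
Proof.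
move=> fF; elim: s => [|i s IHs] /=; first exact: tens_refl.
exact: (@tens_cat _ _ [:: _]).
Qed.

Lemma tensor_eq_suml (I : Type) (s : seq I) (f : I -> S) t :
  [:: (\sum_(i <- s) f i, t)] =t [seq (f i, t) | i <- s].
Proof.
elim: s => [|i s IHs] /=; first by rewrite big_nil; apply: tens_zero.
rewrite big_cons; apply: tens_trans (tens_addl _ _ _ _) _.
by apply: (@tens_cat _ _ [:: _] [:: _] [:: _]); first exact: tens_refl.
Qed.

(** The empty sum is the relation s (x) 0 = 0, which is derived by moving the
    scalar 0 across the tensor sign; this is why R must contain 0. *)
Lemma tensor_eq_sumr (I : Type) (r : seq I) s (f : I -> S) : R 0 ->
  [:: (s, \sum_(i <- r) f i)] =t [seq (s, f i) | i <- r].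
Proof.
move=> R0; elim: r => [|i r IHr] /=.
  rewrite big_nil -[X in (s, X)](mul0r 0); apply: tens_trans (tens_sym _) _.
    exact: tens_bal.
  by rewrite mulr0; apply: tens_zero.
rewrite big_cons; apply: tens_trans (tens_addr _ _ _ _) _.
by apply: (@tens_cat _ _ [:: _] [:: _] [:: _]); first exact: tens_refl.
Qed.

Lemma tensor_eq_sum_bal (I : Type) (r : seq I) (f c : I -> S) t :
    (forall i, R (c i)) ->
  [:: (\sum_(i <- r) f i * c i, t)] =t [seq (f i, c i * t) | i <- r].
Proof.
move=> Rc; apply: tens_trans (tensor_eq_suml _ _ _) _.
rewrite -[X in _ =t X]flatten_map1; apply: tensor_eq_map => i.
exact: tens_bal.
Qed.

End Tensors.

Lemma perm_allpairs_swap (I J : Type) (E : eqType) (f : I -> J -> E) s t :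
  perm_eq [seq f i j | i <- s, j <- t] [seq f i j | j <- t, i <- s].
Proof.
elim: t => [|j t IHt] /=; first by elim: s.
by rewrite (perm_allpairs_consr _ _ (fun=> j) (fun=> t)) perm_cat2l.
Qed.

(** * The ring of block matrices *)

Section BlockMatrices.
Variables (A : comNzRingType) (B : idealr A).
Implicit Types (d e : bool) (M N : Smx B).

(** The index set is split into the first two indices and the last one; an
    entry has degree 1 when its row and column lie in different blocks.  With
    this, membership in R and in T is homogeneity of degree 0 and 1, and the
    products of components are governed by additivity of the degree. *)
Local Notation deg i j := ((i == ord_max) (+) (j == ord_max)).

Definition homogeneous d (M : 'M[A]_3) : Prop :=
  forall i j, deg i j != d -> M i j = 0.

Lemma RsetP M : Rset B M <-> homogeneous false M.
Proof.
split=> [/'forall_forallP RM i j|HM].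
  have := RM i j.
  by case: i => -[|[|[|]]] // ?; case: j => -[|[|[|]]] // ? /eqP.
apply/'forall_forallP => i j; move: (HM i j).
by case: i => -[|[|[|]]] // ?; case: j => -[|[|[|]]] // ? /(_ isT)/eqP.
Qed.

Lemma Smx_ideal M i j : deg i j -> M i j \in B.
Proof.
case: M => M /= /'forall_forallP/(_ i j).
by case: i => -[|[|[|]]] // ?; case: j => -[|[|[|]]].
Qed.

Lemma TsetP M : Tset B M <-> homogeneous true M.
Proof.
split=> [/'forall_forallP RM i j|HM].
  have := RM i j.
  by case: i => -[|[|[|]]] // ?; case: j => -[|[|[|]]] // ? /eqP.
apply/'forall_forallP => i j; move: (HM i j) (@Smx_ideal M i j).
by case: i => -[|[|[|]]] // ?; case: j => -[|[|[|]]] // ? M0 MB;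
   first [exact/eqP/M0 | exact: MB].
Qed.

Lemma homogeneous_subgroup d :
  additive_subgroup [set M : Smx B | homogeneous d M]%classic.
Proof.
split=> [i j _|M N HM HN i j ij]; first by rewrite mxE.
by rewrite !mxE HM ?HN ?subrr.
Qed.

Lemma homogeneousM d e M N :
  homogeneous d M -> homogeneous e N -> homogeneous (d (+) e) (M * N : Smx B).
Proof.
move=> HM HN i j ij; rewrite mxE big1 // => k _.
have [ik|/HM->] := eqVneq (deg i k) d; last first.
  by rewrite mul0r.
rewrite [N k j]HN ?mulr0 //; apply: contra_neq ij => <-; rewrite -ik.
by case: (i == _) (k == _) (j == _) => [] [] [].
Qed.

Lemma RsetE : Rset B = [set M : Smx B | homogeneous false M]%classic.
Proof. by apply/predeqP => M; apply: RsetP. Qed.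

Lemma TsetE : Tset B = [set M : Smx B | homogeneous true M]%classic.
Proof. by apply/predeqP => M; apply: TsetP. Qed.

Lemma Spred_deg1 (M : 'M[A]_3) :
  (forall i j, deg i j -> M i j \in B) -> M \in Spred B.
Proof.
move=> MB; apply/'forall_forallP => i j; move: (MB i j).
by case: i => -[|[|[|]]] // ?; case: j => -[|[|[|]]] // ?; apply.
Qed.

Lemma Smx_eq M N : (forall i j, M i j = N i j) -> M = N.
Proof. by move=> MN; apply/val_inj/matrixP. Qed.

Lemma Smx_dec M : exists2 N, Rset B N & Tset B (M - N).
Proof.
pose D := \matrix_(i, j) if deg i j then 0 else M i j.
have SD : D \in Spred B by apply: Spred_deg1 => i j ij; rewrite mxE ij rpred0.
exists (SMx SD); [apply/RsetP => i j|apply/TsetP => i j]; rewrite !mxE.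
  by case: ifP.
by case: ifP => // _ _; rewrite subrr.
Qed.

Lemma Rset_Tset_eq0 M : Rset B M -> Tset B M -> M = 0.
Proof.
move=> /RsetP RM /TsetP TM; apply: Smx_eq => i j; rewrite [RHS]mxE.
by case: (boolP (deg i j)) => ij; [apply: RM|apply: TM];
   rewrite ?ij ?(negPf ij).
Qed.

(** This makes multiplication by 1_B the identity on T, and TT a set of
    matrices over B. *)
Lemma Tset_ideal M i j : Tset B M -> M i j \in B.
Proof.
move/TsetP=> TM; case: (boolP (deg i j)) => ij.
  exact: Smx_ideal.
by rewrite TM ?(negPf ij) ?rpred0.
Qed.

Lemma Sscalar_subproof (a : A) : a%:M \in Spred B.
Proof.
apply: Spred_deg1 => i j; rewrite mxE.
by have [->|_ _] := eqVneq i j; rewrite ?addbb // rpred0.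
Qed.

Definition Sscalar a : Smx B := SMx (Sscalar_subproof a).

Lemma Rset_scalar a : Rset B (Sscalar a).
Proof.
by apply/RsetP => i j; rewrite mxE; have [->|//] := eqVneq i j; rewrite addbb.
Qed.

Lemma Sscalar_mull a M i j : (Sscalar a * M) i j = a * M i j.
Proof. by rewrite -[LHS]/((a%:M *m Smx_val M) i j) mul_scalar_mx mxE. Qed.

Lemma Sscalar_mulr a M i j : (M * Sscalar a) i j = a * M i j.
Proof. by rewrite -[LHS]/((Smx_val M *m a%:M) i j) mul_mx_scalar mxE. Qed.

Lemma not_strongly_graded : ~ strongly_graded (Z2_family (Rset B) (Tset B)).
Proof.
case=> _ /(_ 1 1) TT_R.
have TT1 : (Tset B ** Tset B) 1.
  by rewrite (TT_R : Tset B ** Tset B = Rset B); exact: (Rset_scalar 1).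
pose Z := [set M : Smx B | forall i j, M i j \in B]%classic.
have Zadd : additive_subgroup Z.
  split=> [i j|M N ZM ZN i j]; first by rewrite mxE rpred0.
  by rewrite !mxE rpredB ?ZM ?ZN.
have TTZ M N : Tset B M -> Tset B N -> Z (M * N).
  move=> TM TN i j; rewrite mxE rpred_sum // => k _.
  exact/idealMr/Tset_ideal.
have := set_prod_sub Zadd TTZ TT1 ord0 ord0.
by rewrite mxE eqxx idealr1.
Qed.

Variable b : A.
Hypotheses (bB : b \in B) (b_id : forall a, a \in B -> b * a = a).

Lemma Sunit_subproof i j : b *: delta_mx i j \in Spred B.
Proof. by apply: Spred_deg1 => k l _; rewrite mxE mulrC idealMr. Qed.

(** Away from the entries of degree 1, the matrix units of S are the usual
    ones; the factor [b] is needed for the others and turns this family into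
    the matrix units of the subring M_3(B), whose identity is [b]. *)
Definition Sunit i j : Smx B := SMx (Sunit_subproof i j).

Lemma SunitE i j k l : Sunit i j k l = b *+ ((k == i) && (l == j)).
Proof. by rewrite !mxE mulr_natr. Qed.

Lemma mul_Sunit i j k l :
  Sunit i j * Sunit k l = if j == k then Sunit i l else 0.
Proof.
apply/val_inj => /=; rewrite -[LHS]/(_ *m _) -scalemxAl -scalemxAr scalerA.
rewrite b_id //; case: eqP => [->|/eqP jk]; first by rewrite mul_delta_mx.
by rewrite mul_delta_mx_0 ?scaler0.
Qed.

Lemma Tset_Sunit i j : deg i j -> Tset B (Sunit i j).
Proof.
move=> ij; apply/TsetP => k l kl; rewrite SunitE.
by case: eqP => //= ki; case: eqP => //= lj; rewrite ki lj ij in kl.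
Qed.

Lemma sum_Sunit : \sum_i Sunit i i = Sscalar b.
Proof.
apply: val_inj; rewrite raddf_sum /= -scaler_sumr.
by rewrite -scalemx1 mx1_sum_delta.
Qed.

Lemma epsilon_strongly_graded_Smx :
  epsilon_strongly_graded (Z2_family (Rset B) (Tset B)).
Proof.
have Rhom := @homogeneous_subgroup false.
have Thom := @homogeneous_subgroup true.
rewrite -RsetE in Rhom; rewrite -TsetE in Thom.
apply: (@epsilon_strongly_graded_Z2 _ _ _ Rhom Thom _ _ _ _ _ _ _ (Sscalar b)).
- by move=> M N /RsetP HM /RsetP HN; apply/RsetP/(homogeneousM HM HN).
- by move=> M N /RsetP HM /TsetP HN; apply/TsetP/(homogeneousM HM HN).
- by move=> M N /TsetP HM /RsetP HN; apply/TsetP/(homogeneousM HM HN).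
- by move=> M N /TsetP HM /TsetP HN; apply/RsetP/(homogeneousM HM HN).
- exact: Smx_dec.
- exact: Rset_Tset_eq0.
- exact: (Rset_scalar 1).
- (* [k i] is an index in the block not containing [i]. *)
  pose k (i : 'I_3) : 'I_3 := if i == ord_max then ord0 else ord_max.
  exists [seq (Sunit i (k i), Sunit (k i) i) | i <- enum 'I_3].
    move=> _ /mapP[i _ ->] /=.
    by split; apply: Tset_Sunit; rewrite /k; case: (i == ord_max).
  rewrite big_map big_enum /=.
  under eq_bigr => i _ do rewrite mul_Sunit eqxx.
  by rewrite sum_Sunit.
- move=> M TM; split; apply: Smx_eq => i j.
    by rewrite Sscalar_mull b_id ?Tset_ideal.
  by rewrite Sscalar_mulr b_id ?Tset_ideal.
Qed.

Lemma not_crossed_product : b != 0 ->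
  ~ unital_partial_crossed_product (Z2_family (Rset B) (Tset B)).
Proof.
move=> /eqP b0 /partial_crossed_product_cyclic/(_ 1)[t Tt Tcyc]; apply: b0.
have row i : i != ord_max -> exists a, forall j, j != ord_max ->
    a * t ord_max j = b *+ (j == i).
  move=> /negPf i_max.
  have /Tcyc[r /RsetP Rr] : Tset B (Sunit ord_max i).
    by apply: Tset_Sunit; rewrite eqxx i_max.
  move/(congr1 (fun N : Smx B => N ord_max)) => rowE.
  exists (r ord_max ord_max) => j j_max.
  move: (congr1 (fun f => f j) rowE); rewrite SunitE eqxx /= => ->.
  rewrite mxE (bigD1 ord_max) //= [X in _ + X]big1 ?addr0 // => k /negPf k_max.
  by rewrite Rr ?mul0r // k_max eqxx.
pose i1 : 'I_3 := lift ord0 ord0.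
have [a aE] := row ord0 isT; have [c cE] := row i1 isT.
have bE : b = (a * t ord_max ord0) * (c * t ord_max i1).
  by rewrite aE // cE // b_id.
by rewrite bE mulrACA [t _ _ * _]mulrC mulrACA aE // mul0r.
Qed.

Lemma sum_SmxE (I : Type) (r : seq I) (F : I -> Smx B) k l :
  (\sum_(i <- r) F i) k l = \sum_(i <- r) F i k l.
Proof.
rewrite -summxE; congr (fun_of_matrix _ k l).
exact: (raddf_sum (val : Smx B -> 'M_3)).
Qed.

(** A column of M_3(B) is a combination of the matrix units of that column,
    with coefficients that can be taken to be scalar matrices, hence in R. *)
Lemma mul_Sunit_colE M i j : M * Sunit i j = \sum_k Sunit k j * Sscalar (M k i).
Proof.
apply: Smx_eq => k l; rewrite mxE sum_SmxE (bigD1 i) // [RHS](bigD1 k) //.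
rewrite Sscalar_mulr !SunitE !eqxx !big1 // => h /negPf hi.
  by rewrite Sscalar_mulr SunitE eq_sym hi mulr0.
by rewrite SunitE hi mulr0.
Qed.

Lemma mul_Sunit_rowE M i j : Sunit i j * M = \sum_k Sscalar (M j k) * Sunit i k.
Proof.
apply: Smx_eq => k l; rewrite mxE sum_SmxE (bigD1 j) // [RHS](bigD1 l) //.
rewrite Sscalar_mull !SunitE !eqxx !andbT !big1 // => [|h /negPf hj|h /negPf hj].
- by rewrite mulrC.
- by rewrite Sscalar_mull SunitE [l == h]eq_sym hj andbF mulr0.
- by rewrite SunitE hj andbF mul0r.
Qed.

Lemma separable_Smx : separable_extension (Rset B).
Proof.
pose v := 1 - Sscalar b.
have R0 : Rset B 0 by rewrite RsetE; have [] := homogeneous_subgroup false.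
have vC M : M * v = v * M.
  rewrite mulrBr mulrBl mulr1 mul1r; congr (_ - _).
  by apply: Smx_eq => i j; rewrite Sscalar_mulr Sscalar_mull.
have vR M : Rset B (M * v).
  apply/RsetP => i j ij; rewrite mulrBr mulr1 mxE [X in _ + X]mxE.
  rewrite Sscalar_mulr b_id ?subrr //.
  by apply: Smx_ideal; move: ij; rewrite eqbF_neg negbK.
exists ((v, 1) :: [seq (Sunit i ord0, Sunit ord0 i) | i <- index_enum 'I_3]).
split.
  rewrite /tens_mul big_cons big_map /= mulr1.
  under eq_bigr => i _ do rewrite mul_Sunit eqxx.
  by rewrite sum_Sunit subrK.
move=> M; rewrite /tens_lact /tens_ract /= -2!map_comp.
apply: (@tens_cat _ _ [:: _] [:: _]).
  rewrite /= mul1r -[M * v]mul1r; apply: tens_trans (tens_bal _ _ (vR M)) _.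
  rewrite mulr1 vC; apply: tens_sym; rewrite -[X in (X, _)]mul1r.
  by apply: tens_bal; rewrite -[v]mul1r.
pose F i k := (Sunit k ord0, Sscalar (M k i) * Sunit ord0 i).
(* Each scalar matrix in [F] lies in R, so it may stand on either side of the
   tensor sign: both M x and x M are the sum of the nine terms [F i k]. *)
pose I3 := index_enum 'I_3.
apply: (@tens_trans _ _ _ [seq F i k | i <- I3, k <- I3]).
  apply: tensor_eq_map => i /=; rewrite mul_Sunit_colE.
  by apply: tensor_eq_sum_bal => k; apply: Rset_scalar.
apply: tens_trans (tensor_eq_perm _ (perm_allpairs_swap _ _ _)) (tens_sym _).
apply: tensor_eq_map => k /=.
by rewrite mul_Sunit_rowE; apply: tensor_eq_sumr.
Qed.

End BlockMatrices.

Theorem proposition38 (A : comNzRingType) (B : idealr A) (oneB : A)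
    (oneB_in : oneB \in B) (oneB_neq0 : oneB != 0)
    (oneB_id : forall b : A, b \in B -> oneB * b = b) :
  [/\ epsilon_strongly_graded (Z2_family (Rset B) (Tset B)),
      ~ strongly_graded (Z2_family (Rset B) (Tset B)),
      ~ unital_partial_crossed_product (Z2_family (Rset B) (Tset B)) &
      separable_extension (Rset B)].
Proof.
split.
- exact: epsilon_strongly_graded_Smx oneB_in oneB_id.
- exact: not_strongly_graded.
- exact: not_crossed_product oneB_in oneB_id oneB_neq0.
- exact: separable_Smx oneB_in oneB_id.
Qed.
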